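(* Let $p$ be a prime number. Let $h\in\mathbb{Z}_p[X]$ be a monic polynomial, and let $f\in\mathbb{F}_p[X]$ be a monic irreducible polynomial of degree at least one. Let $\bar h$ denote the image of $h$ in $\mathbb{F}_p[X]$, and suppose that $f$ divides $\bar h$ but $f^2$ does not. (In this case, by Hensel's lemma, $f$ lifts to a monic factor of $h$ over $\mathbb{Z}_p$; let $\tilde f\in\mathbb{Z}_p[X]$ be this lift, i.e. the first member of the unique pair of monic polynomials $\tilde f,\tilde g\in\mathbb{Z}_p[X]$ with $h=\tilde f\tilde g$ whose images in $\mathbb{F}_p[X]$ are $f$ and $g:=\bar h/f$ respectively.) Let $F\in\mathbb{Z}_p[X]$ be any polynomial whose image in $\mathbb{F}_p[X]$ equals $f$. Then the following statements hold. 1. $A:=\mathbb{Z}_p[X]/(F)$ is a complete discrete valuation ring with maximal ideal $pA$. 2. Let $\bar X$ denote the image of $X$ in $A/pA$. Then the expansion of $$(Y-\bar X)(Y-\bar X^{p})\cdots(Y-\bar X^{p^{\deg f-1}})$$ in $(A/pA)[Y]$ coincides with $f(Y)$. 3. For each $i=0,1,\ldots,\deg f-1$, we have $\bar h'(\bar X^{p^i})\neq 0$. 4. For each $i=0,1,\ldots,\deg f-1$, let $X_i'\in A$ be the result of applying the simple-root form of Hensel's lemma over $A$ to the polynomial $h$ and the approximate root $\alpha=X^{p^i}$, i.e. the unique element of $A$ with $h(X_i')=0$ and $X_i'-X^{p^i}\in pA$ (where $X$ also denotes its image in $A$). Then the expansion of $$(Y-X_0')(Y-X_1')\cdots(Y-X_{\deg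 f-1}')$$ lies in $\mathbb{Z}_p[Y]$ and equals $\tilde f(Y)$.
   Context: $\mathbb{Z}_p$ is the ring of $p$-adic integers and $\mathbb{F}_p=\mathbb{Z}_p/p\mathbb{Z}_p$. A discrete valuation ring (DVR) is complete if it is complete for the metric $|x-y|=\exp(-v(x-y))$ induced by its valuation $v$. $\bar h'$ denotes the derivative of $\bar h$. Hensel's lemma (simple-root form): if $A$ is a complete DVR with maximal ideal $\mathfrak m$, $h\in A[X]$ is monic, and $\alpha\in A$ satisfies $h(\alpha)\in\mathfrak m$ and $h'(\alpha)\notin\mathfrak m$, then there exists a unique $\alpha'\in A$ with $h(\alpha')=0$ and $\alpha'-\alpha\in\mathfrak m$.
   Formalization: Statements 1 and 4 are given only for F with deg F = deg f; for deg F > deg f, e.g. f = X and F = X(1+pX), the ring A is a product of two nonzero rings, so it is not a DVR and statement 1 fails. *)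

(* Defs.v *)
From HB Require Import structures.
From mathcomp Require Import all_boot all_order all_algebra.
From mathcomp Require Import boolp classical_sets reals sequences.

Set Implicit Arguments.
Unset Strict Implicit.
Unset Printing Implicit Defensive.

Import Order.TTheory GRing.Theory Num.Theory.
Local Open Scope classical_set_scope.
Local Open Scope ring_scope.
Local Open Scope quotient_scope.

Definition Zcast (m d : nat) (x : 'Z_m) : 'Z_d := (x : nat)%:R.

Section Zcast.
Variables m d : nat.
Hypothesis dm : ((Zp_trunc d).+2 %| (Zp_trunc m).+2)%N.

Lemma Zcast1 : Zcast d (1 : 'Z_m) = 1.
Proof. by []. Qed.

Lemma Zcast_mod k : ((k %% (Zp_trunc m).+2)%N)%:R = k%:R :> 'Z_d.
Proof. by rewrite !Zp_nat; apply: val_inj => /=; rewrite modn_dvdm. Qed.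

Lemma ZcastD (x y : 'Z_m) : Zcast d (x + y) = Zcast d x + Zcast d y.
Proof. by rewrite /Zcast /= Zcast_mod natrD. Qed.

Lemma ZcastM (x y : 'Z_m) : Zcast d (x * y) = Zcast d x * Zcast d y.
Proof. by rewrite /Zcast /= Zcast_mod natrM. Qed.

Lemma ZcastB (x y : 'Z_m) : Zcast d (x - y) = Zcast d x - Zcast d y.
Proof. by apply: (addIr (Zcast d y)); rewrite -ZcastD !subrK. Qed.

Lemma ZcastN (x : 'Z_m) : Zcast d (- x) = - Zcast d x.
Proof. by rewrite -[- x]add0r ZcastB sub0r. Qed.

End Zcast.

Lemma Zp_trunc_pow_dvd (p n : nat) :
  ((Zp_trunc (p ^ n.+1)).+2 %| (Zp_trunc (p ^ n.+2)).+2)%N.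
Proof.
case: p => [|[|p]]; first by rewrite !exp0n.
  by rewrite !exp1n.
by rewrite !Zp_cast ?(ltn_exp2l 0) // (expnS _ n.+1) dvdn_mull.
Qed.

Lemma Zp_trunc_pdiv_dvd (p : nat) :
  ((Zp_trunc (pdiv p)).+2 %| (Zp_trunc (p ^ 1)).+2)%N.
Proof.
case: p => [|[|p]] //; have pr := pdiv_prime (isT : 1 < p.+2)%N.
by rewrite expn1 (Zp_cast (prime_gt1 pr)) (@Zp_cast p.+2) // pdiv_dvd.
Qed.

(* The p-adic integers, as the inverse limit of the rings Z/p^(n+1) (the shift *)
(* avoids Z/1, which 'Z_ does not represent). The construction makes sense for *)
(* every p, but is the intended ring only for p prime.                         *)
Record padic (p : nat) := Padic {
  padic_digit :> forall n, 'Z_(p ^ n.+1);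
  padic_coherent : forall n, Zcast (p ^ n.+1) (padic_digit n.+1) = padic_digit n
}.

Section PadicRing.
Variable p : nat.

Lemma padic_eq (x y : padic p) : (forall n, x n = y n) -> x = y.
Proof.
case: x y => [x cx] [y cy] /= xy.
have e : x = y by apply: functional_extensionality_dep.
by subst y; congr Padic; apply: Prop_irrelevance.
Qed.

HB.instance Definition _ := gen_eqMixin (padic p).
HB.instance Definition _ := gen_choiceMixin (padic p).

Definition padic_zero : padic p.
Proof. by exists (fun n => 0) => n. Defined.

Definition padic_one : padic p.
Proof. by exists (fun n => 1) => n. Defined.

Definition padic_neg (x : padic p) : padic p.
Proof.
exists (fun n => - x n) => n.
by rewrite (ZcastN (Zp_trunc_pow_dvd p n)) padic_coherent.
Defined.

Definition padic_plus (x y : padic p) : padic p.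
Proof.
exists (fun n => x n + y n) => n.
by rewrite (ZcastD (Zp_trunc_pow_dvd p n)) !padic_coherent.
Defined.

Definition padic_times (x y : padic p) : padic p.
Proof.
exists (fun n => x n * y n) => n.
by rewrite (ZcastM (Zp_trunc_pow_dvd p n)) !padic_coherent.
Defined.

Lemma padic_plusA : associative padic_plus.
Proof. by move=> x y z; apply: padic_eq => n /=; rewrite addrA. Qed.
Lemma padic_plusC : commutative padic_plus.
Proof. by move=> x y; apply: padic_eq => n /=; rewrite addrC. Qed.
Lemma padic_plus0 : left_id padic_zero padic_plus.
Proof. by move=> x; apply: padic_eq => n /=; rewrite add0r. Qed.
Lemma padic_plusN : left_inverse padic_zero padic_neg padic_plus.
Proof. by move=> x; apply: padic_eq => n /=; rewrite addNr. Qed.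
Lemma padic_timesA : associative padic_times.
Proof. by move=> x y z; apply: padic_eq => n /=; rewrite mulrA. Qed.
Lemma padic_timesC : commutative padic_times.
Proof. by move=> x y; apply: padic_eq => n /=; rewrite mulrC. Qed.
Lemma padic_times1 : left_id padic_one padic_times.
Proof. by move=> x; apply: padic_eq => n /=; rewrite mul1r. Qed.
Lemma padic_timesD : left_distributive padic_times padic_plus.
Proof. by move=> x y z; apply: padic_eq => n /=; rewrite mulrDl. Qed.
Lemma padic_one_neq0 : padic_one != padic_zero.
Proof.
by apply/eqP => /(congr1 (fun x : padic p => x 0%N)) /eqP; rewrite /= oner_eq0.
Qed.

HB.instance Definition _ :=
  GRing.isZmodule.Build (padic p) padic_plusA padic_plusC padic_plus0 padic_plusN.
HB.instance Definition _ := GRing.Zmodule_isComNzRing.Build (padic p)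
  padic_timesA padic_timesC padic_times1 padic_timesD padic_one_neq0.

Definition padic_red (x : padic p) : 'F_p := Zcast (pdiv p) (x 0%N).

Lemma padic_red_zmod_morphism : zmod_morphism padic_red.
Proof. by move=> x y; apply: (ZcastB (Zp_trunc_pdiv_dvd p)). Qed.

Lemma padic_red_monoid_morphism : monoid_morphism padic_red.
Proof.
by split=> [|x y]; [apply: Zcast1 | apply: (ZcastM (Zp_trunc_pdiv_dvd p))].
Qed.

HB.instance Definition _ :=
  GRing.isZmodMorphism.Build (padic p) 'F_p padic_red padic_red_zmod_morphism.
HB.instance Definition _ :=
  GRing.isMonoidMorphism.Build (padic p) 'F_p padic_red padic_red_monoid_morphism.

End PadicRing.

Notation redp := (map_poly (@padic_red _)).

Section Ideals.
Variable A : comNzRingType.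
Implicit Types (I J : set A) (a x : A).

Definition is_unit x := exists y, y * x = 1.

Definition is_ideal I :=
  [/\ I 0, forall x y, I x -> I y -> I (x + y) & forall a x, I x -> I (a * x)].

Definition principal a : set A := [set x | exists b, x = b * a].

Definition is_prime_ideal I :=
  [/\ is_ideal I, ~ I 1 & forall x y, I (x * y) -> I x \/ I y].

Definition is_maximal_ideal I :=
  [/\ is_ideal I, ~ I 1 & forall J, is_ideal J -> ~ J 1 -> I `<=` J -> J = I].

End Ideals.

(* R/(a). Ring types of MathComp that carry polynomials are nontrivial, so the *)
(* quotient by a unit is replaced by R/(0); see pidealE for the proper case.   *)
Definition pideal (R : comNzRingType) (a : R) : {pred R} :=
  fun x => if `[< is_unit a >] then x == 0 else `[< principal a x >].

Lemma pidealE (R : comNzRingType) (a x : R) :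
  ~ is_unit a -> (x \in pideal a) <-> exists b, x = b * a.
Proof.
move=> na; rewrite unfold_in /pideal; case: asboolP => // _.
by split=> /asboolP.
Qed.

Lemma pideal_idealr_closed (R : comNzRingType) (a : R) :
  idealr_closed (pideal a).
Proof.
split=> [||c u v]; rewrite !unfold_in /pideal; case: asboolP => na.
- exact: eqxx.
- by apply/asboolP; exists 0; rewrite mul0r.
- by rewrite oner_eq0.
- by apply/asboolP => -[b e]; apply: na; exists b.
- by move=> /eqP -> /eqP ->; rewrite mulr0 addr0.
- move=> /asboolP[b ->] /asboolP[d ->]; apply/asboolP.
  by exists (c * b + d); rewrite mulrDl mulrA.
Qed.

HB.instance Definition _ (R : comNzRingType) (a : R) :=
  isIdealr.Build R (pideal a) (pideal_idealr_closed a).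

Notation princ_quot a := {ideal_quot (pideal a)}.

Definition is_dvr (A : comNzRingType) :=
  [/\ GRing.integral_domain_axiom A,
      forall I : set A, is_ideal I -> exists a, I = principal a
    & exists! P : set A, is_prime_ideal P /\ P <> [set 0]].

Section Complete.
Variables (R : realType) (A : comNzRingType).

(* x = u t^n with t a uniformizer and u a unit *)
Definition has_valuation (x : A) (n : nat) :=
  exists t u, [/\ is_maximal_ideal (principal t), is_unit u & x = u * t ^+ n].

Definition valuation (x : A) : nat := xget 0%N [set n | has_valuation x n].

(* exp(- v(x - y)), with v(0) = +oo *)
Definition dvr_dist (x y : A) : R :=
  if x == y then 0 else expR (- (valuation (x - y))%:R).

Definition dvr_cauchy (u : nat -> A) :=
  forall e : R, 0 < e -> exists N : nat,
    forall m n, (N <= m)%N -> (N <= n)%N -> dvr_dist (u m) (u n) < e.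

Definition dvr_converges (u : nat -> A) (l : A) :=
  forall e : R, 0 < e -> exists N : nat,
    forall n, (N <= n)%N -> dvr_dist (u n) l < e.

Definition is_complete_dvr :=
  is_dvr A /\ forall u, dvr_cauchy u -> exists l, dvr_converges u l.

End Complete.

Section Setting.
Variable p : nat.

Definition hensel_pair (h : {poly padic p}) (f : {poly 'F_p})
    (ft gt : {poly padic p}) :=
  [/\ ft \is monic, gt \is monic, h = ft * gt, redp ft = f
    & redp gt = redp h %/ f].

Variable F : {poly padic p}.

Definition padicX_quot : Type := princ_quot F.
HB.instance Definition _ := GRing.ComNzRing.on padicX_quot.

Definition Xim : padicX_quot := \pi_(princ_quot F) 'X.

Definition padic_to_quot (c : padic p) : padicX_quot := \pi_(princ_quot F) c%:P.

Definition padicX_quot_modp : Type := princ_quot (p%:R : padicX_quot).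
HB.instance Definition _ := GRing.ComNzRing.on padicX_quot_modp.

Definition Xbar : padicX_quot_modp := \pi_(princ_quot (p%:R : padicX_quot)) Xim.

(* the ring morphism from 'F_p, sending the class of n to the class of n *)
Definition Fp_to_quot (c : 'F_p) : padicX_quot_modp := (c : nat)%:R.

(* x is the output of Hensel's lemma in A for h and the approximate root a *)
Definition hensel_root (h : {poly padic p}) (a x : padicX_quot) :=
  root (map_poly padic_to_quot h) x /\ principal (p%:R : padicX_quot) (x - a).

End Setting.

(* Main.v *)
Require Import Defs.
From HB Require Import structures.
From mathcomp Require Import all_boot all_order all_algebra.
From mathcomp Require Import boolp classical_sets reals sequences exp.
From mathcomp Require Import ring zify qpoly finfield.

(* A ring that is complete and separated for the powers of a regular element  *)
(* t generating a maximal ideal satisfies Hensel's lemma by Newton iteration; *)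
(* applied to a Y - 1, this makes every element outside (t) a unit, so every  *)
(* nonzero element is a unit times a power of t, and the ring is a complete   *)
(* DVR. Division by F, whose leading coefficient is a unit, carries           *)
(* completeness over from the coefficients in Z_p to A = Z_p[X]/(F), and      *)
(* A/pA = F_p[X]/(f) is a field.                                              *)
(*   The conjugates Xbar^(p^i) are roots of f because F_p is fixed by         *)
(* Frobenius, and they are distinct because A/pA has p^(deg f) elements. They *)
(* are then simple roots of hbar, as f^2 does not divide hbar, and Hensel's   *)
(* lemma lifts them to roots of h in A; the cofactor of ft does not vanish at *)
(* these lifts, so they are deg f distinct roots of ft in a domain.           *)
(*   The factor ft is a limit of monic f_n with h = q_n f_n + p^n r_n, where  *)
(* f_n is corrected by p^n times the remainder of v r_n modulo f, with        *)
(* u f + v g = 1.                                                             *)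

Set Implicit Arguments.
Unset Strict Implicit.
Unset Printing Implicit Defensive.

Import Order.TTheory GRing.Theory Num.Theory.
Local Open Scope ring_scope.
Local Open Scope quotient_scope.

(** Two tools carry the proof. The first is the criterion [adic_complete_dvr]: if t is regular, A is
    complete and separated for its powers and A/(t) is a field, then A is a complete DVR; its engine
    is [adic_hensel]. The second is the dictionary [principal_pi_quotP]: p divides the class of P in
    A exactly when f divides the reduction of P. Through [horner_conjugate_eq0] and
    [principal_horner_conjugate] it turns vanishing modulo p at a conjugate of X into divisibility
    by f, where the hypothesis on f and f^2 applies directly. Both product formulas are then one
    count of roots in a domain, [domain_monic_roots_prod], over A/pA for f and over A for ft. The
    ring A/pA is F_p[X]/(f) for every lift F, whereas completeness of A uses that F has the degree
    of f. The pair exists by [hensel_factor]; it is unique because a second lift of f may itself be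
    taken as F. *)

(** * Principal ideals, Taylor expansion, and roots in a domain *)

Section Principal.
Variable A : comNzRingType.
Implicit Types (a x y : A) (q : {poly A}).

Lemma principalD a x y : principal a x -> principal a y -> principal a (x + y).
Proof. by move=> [b ->] [c ->]; exists (b + c); rewrite mulrDl. Qed.

Lemma principalMl a x y : principal a y -> principal a (x * y).
Proof. by move=> [c ->]; exists (x * c); rewrite mulrA. Qed.

Lemma principalMr a x y : principal a x -> principal a (x * y).
Proof. by rewrite mulrC; apply: principalMl. Qed.

Lemma principalN a x : principal a x -> principal a (- x).
Proof. by rewrite -mulN1r; apply: principalMl. Qed.

Lemma principalB a x y : principal a x -> principal a y -> principal a (x - y).
Proof. by move=> ax ay; apply/principalD/principalN. Qed.

Lemma principal_self a : principal a a.
Proof. by exists 1; rewrite mul1r. Qed.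

Lemma principal_trans a b x : principal a b -> principal b x -> principal a x.
Proof. by move=> [c ->] [d ->]; exists (d * c); rewrite mulrA. Qed.

Lemma principal_exp a (m n : nat) : (m <= n)%N -> principal (a ^+ m) (a ^+ n).
Proof. by move=> mn; exists (a ^+ (n - m)); rewrite -exprD subnK. Qed.

Lemma principal_is_ideal a : is_ideal (principal a).
Proof.
split=> [|x y|c x]; [by exists 0; rewrite mul0r | exact: principalD |].
exact: principalMl.
Qed.

(** The second-order remainder is left unspecified, so no factorial is divided by and the expansion
    holds over every commutative ring. *)
Lemma horner_taylor2 q x d :
  exists r, q.[x + d] = q.[x] + d * q^`().[x] + d ^+ 2 * r.
Proof.
elim/poly_ind: q => [|q c [r IH]].
  by exists 0; rewrite deriv0 !horner0; ring.
exists (q^`().[x] + (x + d) * r).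
by rewrite derivD derivM derivX derivC !hornerE IH; ring.
Qed.

Lemma horner_cong a q x y : principal a (x - y) -> principal a (q.[x] - q.[y]).
Proof.
move=> axy; have [r e] := horner_taylor2 q y (x - y).
rewrite -(subrK y x) [x - y + y]addrC e.
have -> : q.[y] + (x - y) * q^`().[y] + (x - y) ^+ 2 * r - q.[y]
        = (x - y) * (q^`().[y] + (x - y) * r) by ring.
exact: principalMr.
Qed.

(* Replaces the library's uniq_roots lemmas, which need a ring with decidable units. *)
Lemma domain_roots_prod (I : eqType) (s : seq I) (z : I -> A) q :
  GRing.integral_domain_axiom A ->
  uniq s -> {in s &, injective z} -> all (fun i => root q (z i)) s ->
  exists r, q = r * \prod_(i <- s) ('X - (z i)%:P).
Proof.
move=> dom; elim: s q => [|i s IH] q; first by exists q; rewrite big_nil mulr1.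
move=> /= /andP[si us] inj /andP[ri rs].
have /factor_theorem[r qE] := ri.
have [||r' rE] := IH r us.
- by move=> j k js ks; apply: inj; rewrite inE (js, ks) orbT.
- apply/allP => j js; have := allP rs j js; rewrite qE /root !hornerE.
  move=> /eqP/dom/orP[//|]; rewrite subr_eq0 => /eqP/inj.
  by rewrite !inE eqxx js orbT => /(_ isT isT) ji; rewrite -ji js in si.
- by exists r'; rewrite big_cons {1}qE {1}rE -!mulrA [_ * ('X - (z i)%:P)]mulrC.
Qed.

Lemma monic_size1 q : q \is monic -> size q = 1%N -> q = 1.
Proof.
move=> mq sq; move: mq; rewrite [q]size1_polyC ?sq // monicE lead_coefC.
by move=> /eqP ->.
Qed.

(** The product divides q, and comparing degrees makes the cofactor monic of degree 0. *)
Lemma domain_monic_roots_prod (n : nat) (z : 'I_n -> A) q :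
  GRing.integral_domain_axiom A -> q \is monic -> size q = n.+1 ->
  injective z -> (forall i, root q (z i)) ->
  q = \prod_i ('X - (z i)%:P).
Proof.
move=> dom mq sq inj rq.
have [||r qE] := @domain_roots_prod _ (index_enum 'I_n) z q dom (index_enum_uniq _).
- by move=> i j _ _; apply: inj.
- by apply/allP => i _; apply: rq.
set P := \prod_(i <- _) _ in qE *.
have mP : P \is monic by apply: monic_prod => i _; apply: monicXsubC.
have sP : size P = n.+1.
  rewrite /P size_prod_XsubC /index_enum -enumT size_enum_ord //.
have mr : r \is monic by move: mq; rewrite qE monicMr.
rewrite qE (monic_size1 mr) ?mul1r //.
have r0 : r != 0 by apply: monic_neq0.
have := size_Mmonic r0 mP; rewrite -qE sP sq addnS /= addnC.
by rewrite -addn1 => /eqP; rewrite eqn_add2l => /eqP.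
Qed.
End Principal.

(** * Adically complete rings *)

(** Surjectivity of A onto the inverse limit of the A/(t^n); [adic_separated] is injectivity of the
    same map. *)
Definition adic_complete (A : comNzRingType) (t : A) :=
  forall u : nat -> A, (forall n, principal (t ^+ n) (u n.+1 - u n)) ->
  exists l, forall n, principal (t ^+ n) (l - u n).

Definition adic_separated (A : comNzRingType) (t : A) :=
  forall x, (forall n, principal (t ^+ n) x) -> x = 0.

Section Adic.
Variables (A : comNzRingType) (t : A).
Hypothesis complete_t : adic_complete t.
Hypothesis separated_t : adic_separated t.
Hypothesis field_t :
  forall x, ~ principal t x -> exists y, principal t (y * x - 1).
Hypothesis proper_t : ~ principal t 1.
Implicit Types (x y : A) (q : {poly A}).

(** The slope c, an inverse of q'(a) modulo t, stays fixed along the iteration. Each step then gains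
    only one factor t, which suffices, and no inverse in A is presupposed, so [adic_unit] can be
    deduced from this lemma. *)
Lemma adic_hensel q a c :
  principal t q.[a] -> principal t (c * q^`().[a] - 1) ->
  exists x, root q x /\ principal t (x - a).
Proof.
move=> qa dqa.
pose u := fix u n := if n is n'.+1 then u n' - c * q.[u n'] else a.
have uP n : principal (t ^+ n.+1) q.[u n] /\ principal t (u n - a).
  elim: n => [|n [IHq IHa]].
    by rewrite expr1 subrr; split=> //; exists 0; rewrite mul0r.
  have tt : principal t q.[u n].
    by apply: principal_trans IHq; rewrite -{1}[t]expr1; apply: principal_exp.
  split; last first.
    rewrite /= addrAC; apply: principalB => //; exact: principalMl.
  have [r e] := horner_taylor2 q (u n) (- (c * q.[u n])).
  rewrite /= e.
  have -> : q.[u n] + - (c * q.[u n]) * q^`().[u n] + (- (c * q.[u n])) ^+ 2 * r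
     = q.[u n] * (- (c * q^`().[u n] - 1)) + q.[u n] * (q.[u n] * (c ^+ 2 * r))
     by ring.
  have mulP x : principal t x -> principal (t ^+ n.+2) (q.[u n] * x).
    move: IHq => [b ->] [d ->]; exists (b * d).
    by rewrite !exprS; ring.
  apply: principalD; apply: mulP; last exact: principalMr.
  apply: principalN.
  have -> : c * q^`().[u n] - 1 =
    c * (q^`().[u n] - q^`().[a]) + (c * q^`().[a] - 1) by ring.
  by apply: principalD dqa; apply/principalMl/horner_cong.
have [n|x xP] := complete_t (u := u).
  rewrite /= addrAC subrr add0r; apply/principalN/principalMl.
  by apply: principal_trans (uP n).1; apply: principal_exp.
exists x; split.
  apply/eqP/separated_t => n.
  rewrite -[q.[x]](subrK q.[u n]); apply: principalD.
    exact/horner_cong/xP.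
  by apply: principal_trans (uP n).1; apply: principal_exp.
(* The comparison goes through index 1, because closeness to [u 0] is only modulo t^0 = 1. *)
have -> : x - a = (x - u 1%N) + (u 1%N - a) by ring.
by apply: principalD (uP 1%N).2; have := xP 1%N; rewrite expr1.
Qed.

Lemma adic_unit x : ~ principal t x -> is_unit x.
Proof.
move=> /field_t[y yx].
have hE z : (x *: 'X - 1 : {poly A}).[z] = x * z - 1 by rewrite !hornerE.
(* The residual inverse y is both the approximate root and the slope, the derivative being the
   constant x. *)
have [||z [/eqP]] := @adic_hensel (x *: 'X - 1) y y.
- by rewrite hE mulrC.
- by rewrite derivB derivZ derivX derivC subr0 hornerZ hornerC mulr1.
by rewrite hE => e _; exists z; apply/eqP; rewrite mulrC -subr_eq0 e.
Qed.

(** By Taylor, 0 = (y - x)(q'(x) + (y - x) r), and the second factor is a unit since it is congruent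
    to q'(x) modulo t. *)
Lemma adic_hensel_uniq q c x y :
  principal t (c * q^`().[x] - 1) -> principal t (x - y) ->
  root q x -> root q y -> x = y.
Proof.
move=> dqx xy /eqP qx /eqP qy.
have [r] := horner_taylor2 q x (y - x).
rewrite addrC subrK qx qy add0r => e.
have /adic_unit[v ve] : ~ principal t (q^`().[x] + (y - x) * r).
  move=> tq; apply: proper_t.
  have -> : 1 = c * (q^`().[x] + (y - x) * r) + c * r * (x - y)
                - (c * q^`().[x] - 1) by ring.
  by apply: principalB dqx; apply: principalD; apply: principalMl.
apply/eqP; rewrite -subr_eq0 -oppr_eq0 opprB -[_ - _]mulr1 -ve.
have -> : (y - x) * (v * (q^`().[x] + (y - x) * r))
        = v * ((y - x) * q^`().[x] + (y - x) ^+ 2 * r) by ring.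
by rewrite -e mulr0.
Qed.

Hypothesis regular_t : forall x, t * x = 0 -> x = 0.

Lemma regular_exp n x : t ^+ n * x = 0 -> x = 0.
Proof.
by elim: n => [|n IH]; [rewrite mul1r | rewrite exprS -mulrA => /regular_t/IH].
Qed.

(** Separation bounds the powers of t dividing x; for the largest one the cofactor lies outside
    (t). *)
Lemma adic_unit_exp x : x <> 0 -> exists n u, is_unit u /\ x = u * t ^+ n.
Proof.
move=> x0.
have [n nP] : exists n, ~ principal (t ^+ n) x.
  by apply/existsNP => xP; apply/x0/separated_t.
elim: n nP => [[]|n IH nP]; first by exists x; rewrite mulr1.
have [[u uE]|] := pselect (principal (t ^+ n) x); last exact: IH.
exists n, u; split=> //; apply: adic_unit => -[b e]; apply: nP.
by exists b; rewrite uE e exprS mulrA.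
Qed.

(** If m > n, cancelling the regular t^n leaves 1 as a multiple of t. *)
Lemma principal_unit_exp u m n :
  is_unit u -> principal (t ^+ m) (u * t ^+ n) -> (m <= n)%N.
Proof.
move=> [v vu] [b e]; rewrite leqNgt; apply/negP => nm.
have : t ^+ n * (1 - v * b * t ^+ (m - n)) = 0.
  rewrite mulrBr mulr1 mulrCA -exprD subnKC 1?ltnW // -mulrA -e mulrA vu.
  by rewrite mul1r subrr.
move=> /regular_exp/eqP; rewrite subr_eq0 => /eqP e1; apply: proper_t.
rewrite e1; apply: principalMl; rewrite -{1}[t]expr1.
by apply: principal_exp; rewrite subn_gt0.
Qed.

Lemma is_unitM x y : is_unit x -> is_unit y -> is_unit (x * y).
Proof.
move=> [v vx] [w wy]; exists (w * v).
have -> : w * v * (x * y) = (w * y) * (v * x) by ring.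
by rewrite wy vx mulr1.
Qed.

Lemma adic_domain : GRing.integral_domain_axiom A.
Proof.
move=> x y xy; apply: contrapT => /negP.
rewrite negb_or => /andP[/eqP/adic_unit_exp[m [u [uu xE]]]].
move=> /eqP/adic_unit_exp[n [v [uv yE]]].
have [w wE] := is_unitM uu uv.
have : t ^+ (m + n) * 1 = 0.
  have -> : t ^+ (m + n) * 1 = w * (x * y).
    rewrite xE yE -wE exprD; ring.
  by rewrite xy mulr0.
by move=> /regular_exp/eqP; rewrite oner_eq0.
Qed.

Lemma adic_maximal_principal : is_maximal_ideal (principal t).
Proof.
split=> // [|J Jid J1 tJ]; first exact: principal_is_ideal.
apply/seteqP; split=> // x Jx; apply: contrapT => /adic_unit[y e].
by apply: J1; rewrite -e; case: Jid => _ _; apply.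
Qed.

(** [has_valuation] accepts a generator of any maximal ideal as uniformizer; this confines the
    choice to associates of t. *)
Lemma adic_maximalP (I : set A) : is_maximal_ideal I <-> I = principal t.
Proof.
split=> [[Iid I1 Imax]|->]; last exact: adic_maximal_principal.
apply/esym/Imax => //; first exact: principal_is_ideal.
move=> x Ix; apply: contrapT => /adic_unit[y e].
by apply: I1; rewrite -e; case: Iid => _ _; apply.
Qed.

Lemma adic_ideal_principal (I : set A) :
  is_ideal I -> exists a, I = principal a.
Proof.
move=> [I0 ID IM].
have [[x [Ix x0]]|noI] := pselect (exists x, I x /\ x <> 0); last first.
  exists 0; apply/seteqP; split=> [x Ix|x [b ->]]; last by rewrite mulr0.
  exists 0; rewrite mulr0; apply: contrapT => x0; apply: noI; by exists x.
have expP : exists n, `[< I (t ^+ n) >].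
  have [n [u [[v vu] e]]] := adic_unit_exp x0; exists n; apply/asboolP.
  by rewrite -[t ^+ n]mul1r -vu -mulrA -e; apply: IM.
case: (ex_minnP expP) => n /asboolP In nmin; exists (t ^+ n).
apply/seteqP; split=> [y Iy|y [b ->]]; last exact: IM.
have [->|/eqP y0] := eqVneq y 0; first by exists 0; rewrite mul0r.
have [m [u [[v vu] e]]] := adic_unit_exp y0.
rewrite e; apply/principalMl/principal_exp/nmin/asboolP.
by rewrite -[t ^+ m]mul1r -vu -mulrA -e; apply: IM.
Qed.

Lemma adic_prime_principal : is_prime_ideal (principal t).
Proof.
split=> // [|x y txy]; first exact: principal_is_ideal.
have [|/adic_unit[z e]] := pselect (principal t x); first by left.
by right; rewrite -[y]mul1r -e -mulrA; apply: principalMl.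
Qed.

Lemma adic_dvr : is_dvr A.
Proof.
split; [exact: adic_domain | exact: adic_ideal_principal |].
exists (principal t); split.
  split; first exact: adic_prime_principal.
  move=> e; have := principal_self t; rewrite e /= => t0.
  have : t * 1 = 0 by rewrite t0 mul0r.
  by move=> /regular_t/eqP; rewrite oner_eq0.
move=> P [[[P0 PD PM] P1 PP] Pn0].
have [x [Px x0]] : exists x, P x /\ x <> 0.
  apply: contrapT => noP; apply: Pn0; apply/seteqP; split=> [x Px|x ->//] /=.
  by apply: contrapT => x0; apply: noP; exists x.
have [n [u [[v vu] e]]] := adic_unit_exp x0.
have : P (t ^+ n) by rewrite -[t ^+ n]mul1r -vu -mulrA -e; apply: PM.
move=> Pn; have Pt : P t.
  by elim: n Pn {e} => [//|n IH]; rewrite exprS => /PP[].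
have [_ _ max] := adic_maximal_principal.
by apply/esym/max => // y [b ->]; apply: PM.
Qed.

(** Another uniformizer is c t with c a unit, and c^n is absorbed in the unit factor. *)
Lemma adic_has_valuation u m n :
  is_unit u -> has_valuation (u * t ^+ m) n -> n = m.
Proof.
move=> uu [s [v [/adic_maximalP st uv e]]].
have /adic_maximalP sP := adic_maximal_principal.
have [c cE] : principal t s by rewrite -st; apply: principal_self.
have [d dE] : principal s t by rewrite st; apply: principal_self.
have uc : is_unit c.
  exists d; apply/eqP; rewrite -subr_eq0; apply/eqP/regular_t.
  by rewrite mulrBr mulr1 mulrC -mulrA -cE -dE subrr.
have uX k : is_unit (c ^+ k).
  by elim: k => [|k IH]; rewrite ?exprS; [exists 1; rewrite mulr1 | apply: is_unitM].
have e' : u * t ^+ m = v * c ^+ n * t ^+ n by rewrite e cE exprMn mulrA.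
apply/eqP; rewrite eqn_leq; apply/andP; split.
- by apply: (principal_unit_exp uu); rewrite e'; exists (v * c ^+ n).
- by apply: (principal_unit_exp (is_unitM uv (uX n))); rewrite -e'; exists u.
Qed.

Lemma adic_valuation u n : is_unit u -> valuation (u * t ^+ n) = n.
Proof.
move=> uu; rewrite /valuation; apply: xget_unique.
  by exists t, u; split=> //; apply: adic_maximal_principal.
by move=> m; apply: adic_has_valuation.
Qed.

(** Closed balls of radius exp(-n) are cosets of (t^n), so Cauchy sequences and limits become
    congruences. *)
Lemma dvr_distP (R : realType) x y n :
  (dvr_dist R x y <= expR (- n%:R)) <-> principal (t ^+ n) (x - y).
Proof.
rewrite /dvr_dist; have [->|xy] := eqVneq x y.
  by rewrite subrr expR_ge0; split=> // _; exists 0; rewrite mul0r.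
have /adic_unit_exp[m [u [uu e]]] : x - y <> 0 by apply/eqP; rewrite subr_eq0.
rewrite e adic_valuation // ler_expR lerN2 ler_nat; split=> [mn|].
  exact/principalMl/principal_exp.
exact: principal_unit_exp.
Qed.

Lemma adic_complete_dvr (R : realType) : is_complete_dvr R A.
Proof.
split; first exact: adic_dvr.
move=> u uC.
have /choice[N NP] n : exists N, forall i j, (N <= i)%N -> (N <= j)%N ->
    principal (t ^+ n) (u i - u j).
  have [N NP] := uC _ (expR_gt0 (- n%:R)); exists N => i j Ni Nj.
  exact/(dvr_distP R)/ltW/NP.
have [n|l lP] := complete_t (u := u \o N).
  (* The chosen thresholds [N n] need not increase, hence the detour through the larger of the
     two. *)
  have -> : (u \o N) n.+1 - (u \o N) n = (u (N n.+1) - u (maxn (N n.+1) (N n)))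
            + (u (maxn (N n.+1) (N n)) - u (N n)) by rewrite /=; ring.
  apply: principalD; last by apply: NP => //; apply: leq_maxr.
  apply: (@principal_trans _ _ (t ^+ n.+1)); first exact: principal_exp.
  by apply: NP => //; apply: leq_maxl.
exists l => e e0.
have [n nP] : exists n : nat, expR (- n%:R) < e.
  (* For this n, 1/e < n < 1 + n <= exp(n). *)
  exists (Num.bound e^-1); rewrite expRN invf_plt ?posrE ?expR_gt0 //.
  apply: (lt_le_trans (archi_boundP _)); first by rewrite invr_ge0 ltW.
  by apply: le_trans (expR_ge1Dx _); rewrite lerDr.
exists (N n) => i Ni; apply: le_lt_trans nP; apply/dvr_distP.
have -> : u i - l = (u i - u (N n)) - (l - u (N n)) by ring.
by apply: principalB; [apply: NP | apply: lP].
Qed.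
End Adic.

(** * The p-adic integers *)

Section Padic.
Variable p : nat.
Hypothesis p_pr : prime p.
Implicit Types (x y : padic p) (n : nat).

Lemma pexp_gt1 n : (1 < p ^ n.+1)%N.
Proof. by rewrite -(exp1n n.+1) ltn_exp2r ?prime_gt1. Qed.

Lemma Zp_trunc_exp n : (Zp_trunc (p ^ n.+1)).+2 = (p ^ n.+1)%N.
Proof. exact/Zp_cast/pexp_gt1. Qed.

Lemma ltn_digit x n : (x n < p ^ n.+1)%N.
Proof. by rewrite -[X in (_ < X)%N]Zp_trunc_exp ltn_ord. Qed.

Lemma val_natr_exp n k : (k%:R : 'Z_(p ^ n.+1)) = (k %% p ^ n.+1)%N :> nat.
Proof. by rewrite val_Zp_nat ?pexp_gt1. Qed.

Lemma padic_val_cast x n k : ((x (n + k)%N : nat) %% p ^ n.+1)%N = x n.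
Proof.
elim: k => [|k IH]; first by rewrite addn0 modn_small ?ltn_digit.
rewrite addnS -IH -(padic_coherent x (n + k)) /Zcast val_natr_exp.
by rewrite modn_dvdm // dvdn_exp2l // ltnS leq_addr.
Qed.

Lemma padic_natr k n : (k%:R : padic p) n = k%:R.
Proof. by elim: k => [|k IH]; rewrite ?mulrS //= IH. Qed.

Lemma padicM x y n : (x * y) n = x n * y n. Proof. by []. Qed.
Lemma padicB x y n : (x - y) n = x n - y n. Proof. by []. Qed.

Lemma padic_pexp_digit x n : (p%:R ^+ n.+1 * x) n = 0.
Proof.
rewrite -natrX padicM padic_natr.
have -> : (p ^ n.+1)%:R = 0 :> 'Z_(p ^ n.+1) by rewrite pchar_Zp ?pexp_gt1.
by rewrite mul0r.
Qed.

(** The components of x / p^(n+1). They are read n+1 places further on, since the division costs n+1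
    powers of p; it is exact once [x n] vanishes. *)
Definition padic_shift_digit x n k : 'Z_(p ^ k.+1) :=
  ((x (n.+1 + k)%N : nat) %/ p ^ n.+1)%:R.

Lemma padic_shift_coherent x n k : x n = 0 ->
  Zcast (p ^ k.+1) (padic_shift_digit x n k.+1) = padic_shift_digit x n k.
Proof.
move=> xn; apply: ord_inj; rewrite /Zcast /padic_shift_digit !val_natr_exp.
rewrite modn_dvdm ?dvdn_exp2l //.
have e := padic_coherent x (n.+1 + k).
have e' : ((x (n.+1 + k.+1)%N : nat) %% p ^ (n.+1 + k).+1)%N = x (n.+1 + k)%N.
  by rewrite addnS -e /Zcast val_natr_exp.
rewrite -e'; set d : nat := x _.
have -> : (p ^ (n.+1 + k).+1 = p ^ k.+1 * p ^ n.+1)%N by rewrite -addnS expnD mulnC.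
by rewrite -modn_divl modn_mod.
Qed.

Lemma padic_digit0 x n : x n = 0 -> principal (p%:R ^+ n.+1) x.
Proof.
move=> xn.
exists (Padic (fun k => padic_shift_coherent k xn)).
apply: padic_eq => k; rewrite padicM -natrX padic_natr /= /padic_shift_digit.
rewrite -natrM divnK; last first.
  rewrite /dvdn; have := padic_val_cast x n k.+1; rewrite addnS => ->.
  by rewrite xn.
apply: ord_inj; rewrite val_natr_exp -(padic_val_cast x k n.+1).
by rewrite addnC.
Qed.

Lemma padic_digit0P x n : x n = 0 <-> principal (p%:R ^+ n.+1) x.
Proof.
split=> [|[y ->]]; first exact: padic_digit0.
by rewrite mulrC padic_pexp_digit.
Qed.

(** Multiplication by p loses one level: component n+1 of p x gives p^(n+1) dividing [x n.+1], which
    reduces to [x n]. *)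
Lemma padic_regular x : p%:R * x = 0 -> x = 0.
Proof.
move=> px; apply: padic_eq => n; apply: ord_inj.
have := congr1 (fun y : padic p => y n.+1) px.
rewrite padicM padic_natr -(padic_val_cast x n 1) addn1 -[x n.+1]natr_Zp -natrM.
move=> /(congr1 (@nat_of_ord _)); rewrite !val_natr_exp.
move: (nat_of_ord (x n.+1)) => d /eqP; change (nat_of_ord ((0 : padic p) n.+1)) with 0%N.
rewrite (expnS p n.+1) -muln_modr muln_eq0 => /orP[/eqP p0|/eqP e].
  by move: p_pr; rewrite p0.
by rewrite modn_dvdm ?e // dvdn_mull.
Qed.

Lemma padic_separated : adic_separated (p%:R : padic p).
Proof.
by move=> x xP; apply: padic_eq => n; apply/padic_digit0P/xP.
Qed.

Lemma padic_adic_complete : adic_complete (p%:R : padic p).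
Proof.
move=> u uP.
(* Modulo p^(n+1) the sequence is constant from index n+1 on, so that term supplies component n of
   the limit. *)
have coh n : Zcast (p ^ n.+1) (u n.+2 n.+1) = u n.+1 n.
  rewrite padic_coherent; apply/eqP; rewrite -subr_eq0 -padicB; apply/eqP.
  exact/padic_digit0P.
exists (Padic coh) => -[|n]; first by exists (Padic coh - u 0%N); rewrite mulr1.
by apply/padic_digit0P; rewrite padicB subrr.
Qed.

Lemma padic_red0P x : padic_red x = 0 <-> principal p%:R x.
Proof.
rewrite -[p%:R]expr1 -padic_digit0P.
have -> : padic_red x = (x 0%N : nat)%:R :> 'F_p by [].
split=> [|->//] /(congr1 (@nat_of_ord _)); rewrite val_Fp_nat // => e.
apply: ord_inj; move: e; rewrite modn_small //.
by rewrite -[X in (_ < X)%N]expn1; apply: ltn_digit.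
Qed.

Lemma padic_redK (c : 'F_p) : padic_red ((c : nat)%:R : padic p) = c.
Proof. by rewrite rmorph_nat natr_Zp. Qed.

(** A section of the reduction, coefficient by coefficient with representatives below p. It is not
    additive, so identities between lifts are only checked after reduction. *)
Definition padic_lift (q : {poly 'F_p}) : {poly padic p} :=
  \poly_(i < size q) (nat_of_ord q`_i%R)%:R.

Lemma padic_liftK q : redp (padic_lift q) = q.
Proof.
apply/polyP => i; rewrite coef_map coef_poly.
case: ltnP => [_|sq]; last by rewrite (nth_default 0 sq) raddf0.
exact: padic_redK.
Qed.

Lemma size_padic_lift q : (size (padic_lift q) <= size q)%N.
Proof. exact: size_poly. Qed.

Lemma principal_polyP (c : padic p) (q : {poly padic p}) :
  (forall i, principal c q`_i) -> exists r, q = r * c%:P.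
Proof.
move=> /choice[r rE]; exists (\poly_(i < size q) r i).
apply/polyP => i; rewrite coefMC coef_poly; case: ltnP => [//|/(nth_default 0)->//].
by rewrite mul0r.
Qed.

Lemma redp0P (q : {poly padic p}) : redp q = 0 <-> principal p%:R q.
Proof.
split=> [q0|[r ->]]; last first.
  by rewrite rmorphM /= rmorph_nat -polyC_natr pchar_Fp_0 ?polyC0 ?mulr0.
have [i|r ->] := @principal_polyP p%:R q; last by exists r; rewrite polyC_natr.
by apply/padic_red0P; rewrite -coef_map q0 coef0.
Qed.

Lemma poly_padic_regular (q : {poly padic p}) : p%:R * q = 0 -> q = 0.
Proof.
move=> pq; apply/polyP => i; rewrite coef0; apply: padic_regular.
by rewrite mulr_natl -coefMn -mulr_natl pq coef0.
Qed.

Lemma padic_field x :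
  ~ principal p%:R x -> exists y, principal p%:R (y * x - 1).
Proof.
move=> /padic_red0P/eqP x0; exists ((padic_red x)^-1 : nat)%:R.
by apply/padic_red0P; rewrite rmorphB rmorphM rmorph1 /= padic_redK mulVf ?subrr.
Qed.

End Padic.

(** * The quotient of Z_p[X] by F and its residue field *)

(** The hypothesis on a rules out the case where [pideal] falls back to the zero ideal. *)
Lemma princ_quot_eq0 (R : comNzRingType) (a x : R) :
  ~ is_unit a -> (\pi_(princ_quot a) x = 0) <-> principal a x.
Proof.
move=> /(pidealE x) ideal_x.
apply: iff_trans ideal_x.
rewrite -[x in _ <-> (x \in _)]subr0 Quotient.idealrBE.
have -> : \pi_(princ_quot a) 0 = 0 by apply: rmorph0.
by split=> /eqP.
Qed.

Section QuotientMorphisms.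
Variables (p : nat) (F : {poly padic p}).

Definition pi_quot (P : {poly padic p}) : padicX_quot F := \pi_(princ_quot F) P.

Definition pi_modp (x : padicX_quot F) : padicX_quot_modp F :=
  \pi_(princ_quot (p%:R : padicX_quot F)) x.

Lemma pi_quot_zmod_morphism : zmod_morphism pi_quot.
Proof. by move=> P Q; apply: (rmorphB (\pi_(princ_quot F))). Qed.

Lemma pi_quot_monoid_morphism : monoid_morphism pi_quot.
Proof.
by split=> [|P Q]; [apply: (rmorph1 (\pi_(princ_quot F)))
                   | apply: (rmorphM (\pi_(princ_quot F)))].
Qed.

HB.instance Definition _ := GRing.isZmodMorphism.Build
  {poly padic p} (padicX_quot F) pi_quot pi_quot_zmod_morphism.
HB.instance Definition _ := GRing.isMonoidMorphism.Build
  {poly padic p} (padicX_quot F) pi_quot pi_quot_monoid_morphism.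

Lemma pi_modp_zmod_morphism : zmod_morphism pi_modp.
Proof.
by move=> x y; apply: (rmorphB (\pi_(princ_quot (p%:R : padicX_quot F)))).
Qed.

Lemma pi_modp_monoid_morphism : monoid_morphism pi_modp.
Proof.
by split=> [|x y]; [apply: (rmorph1 (\pi_(princ_quot (p%:R : padicX_quot F))))
                   | apply: (rmorphM (\pi_(princ_quot (p%:R : padicX_quot F))))].
Qed.

HB.instance Definition _ := GRing.isZmodMorphism.Build
  (padicX_quot F) (padicX_quot_modp F) pi_modp pi_modp_zmod_morphism.
HB.instance Definition _ := GRing.isMonoidMorphism.Build
  (padicX_quot F) (padicX_quot_modp F) pi_modp pi_modp_monoid_morphism.

Lemma pi_quot_onto (x : padicX_quot F) : exists P, x = pi_quot P.
Proof. by exists (repr x); rewrite /pi_quot reprK. Qed.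

Lemma pi_modp_onto (x : padicX_quot_modp F) : exists P, x = pi_modp P.
Proof. by exists (repr x); rewrite /pi_modp reprK. Qed.

HB.instance Definition _ := GRing.RMorphism.copy (@padic_to_quot p F)
  (pi_quot \o polyC).

Lemma horner_padic_to_quot (P : {poly padic p}) :
  (map_poly (@padic_to_quot p F) P).[Xim F] = pi_quot P.
Proof.
rewrite -{2}[P]comp_polyXr /comp_poly -horner_map /=.
by rewrite -map_poly_comp.
Qed.

End QuotientMorphisms.

Lemma irreducible_dvd_mul (K : fieldType) (f a b : {poly K}) :
  irreducible_poly f -> f %| a * b -> (f %| a) || (f %| b).
Proof.
move=> irr fab; have [//|fa] := boolP (f %| a).
by move: fab; rewrite Gauss_dvdpr // irreducible_poly_coprime.
Qed.

Section Quotient.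
Variables (p : nat) (f : {poly 'F_p}) (F : {poly padic p}).
Hypotheses (p_pr : prime p) (f_irr : irreducible_poly f) (redF : redp F = f).
Local Notation A := (padicX_quot F).
Local Notation K := (padicX_quot_modp F).
Implicit Types (P Q : {poly padic p}) (g : {poly 'F_p}) (x y : A).

Lemma irreducible_not_unit g : g * f <> 1.
Proof.
move=> gf; have : f %| 1 by rewrite -gf dvdp_mull.
rewrite dvdp1 => /eqP f1; by case: f_irr; rewrite f1.
Qed.

Lemma redp_principal P : principal p%:R P -> redp P = 0.
Proof. by move=> ?; apply/(redp0P p_pr). Qed.

Lemma F_not_unit : ~ is_unit F.
Proof.
move=> [G /(congr1 (fun P => redp P))]; rewrite rmorphM rmorph1 /= redF.
exact: irreducible_not_unit.
Qed.

Lemma pi_quot0P P : pi_quot F P = 0 <-> principal F P.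
Proof. exact/princ_quot_eq0/F_not_unit. Qed.

(** Both sides say that P lies in the ideal (p, F) of Z_p[X]; this is the isomorphism of A/pA with
    F_p[X]/(f). *)
Lemma principal_pi_quotP P : principal (p%:R : A) (pi_quot F P) <-> f %| redp P.
Proof.
split=> [[b]|/dvdpP[g gE]].
  have [B ->] := pi_quot_onto b => e.
  have [C CE] : principal F (P - B * p%:R).
    by apply/pi_quot0P; rewrite rmorphB rmorphM /= rmorph_nat e subrr.
  rewrite -[P](subrK (B * p%:R)) CE rmorphD rmorphM /= redF.
  by rewrite (@redp_principal (B * _)) ?addr0 ?dvdp_mull //; exists B.
have [G GE] : principal p%:R (P - padic_lift g * F).
  apply/(redp0P p_pr); rewrite rmorphB rmorphM /= padic_liftK redF gE.
  by rewrite subrr.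
rewrite -[P](subrK (padic_lift g * F)) GE rmorphD rmorphM /= rmorph_nat.
have -> : pi_quot F (padic_lift g * F) = 0.
  by apply/pi_quot0P; exists (padic_lift g).
by rewrite addr0; exists (pi_quot F G).
Qed.

Lemma padicX_quot_proper : ~ principal (p%:R : A) 1.
Proof.
move=> p1; have /principal_pi_quotP : principal (p%:R : A) (pi_quot F 1).
  by rewrite rmorph1.
rewrite rmorph1 => /dvdpP[g /esym].
exact: irreducible_not_unit.
Qed.

Lemma pi_modp0P x : pi_modp x = 0 <-> principal p%:R x.
Proof.
apply: princ_quot_eq0 => -[y e]; apply: padicX_quot_proper.
by exists y.
Qed.

Lemma pi_modp_eqP x y : pi_modp x = pi_modp y <-> principal p%:R (x - y).
Proof.
rewrite -pi_modp0P rmorphB /=; split=> [->|/eqP]; first by rewrite subrr.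
by rewrite subr_eq0 => /eqP.
Qed.

Lemma padicX_quot_field x :
  ~ principal p%:R x -> exists y, principal p%:R (y * x - 1).
Proof.
have [P ->] := pi_quot_onto x; move/principal_pi_quotP/negP => fP.
have : coprimep f (redp P) by rewrite irreducible_poly_coprime.
move=> /Bezout_eq1_coprimepP[[u v] /= uv].
exists (pi_quot F (padic_lift v)).
have -> : pi_quot F (padic_lift v) * pi_quot F P - 1
        = pi_quot F (padic_lift v * P - 1) by rewrite rmorphB rmorphM rmorph1.
apply/principal_pi_quotP; rewrite rmorphB rmorphM rmorph1 /= padic_liftK.
by rewrite -uv opprD addrCA subrr addr0 dvdpNr dvdp_mull.
Qed.

(** If p P = T F, reduction gives 0 = T f in the domain F_p[X], so p divides T and can be cancelled
    in Z_p[X]. *)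
Lemma padicX_quot_regular x : p%:R * x = 0 -> x = 0.
Proof.
have [P ->] := pi_quot_onto x.
rewrite -(rmorph_nat (@pi_quot _ F)) -rmorphM /= => /pi_quot0P[T TE].
have /(redp0P p_pr)[S SE] : redp T = 0.
  have : redp T * f = 0.
    by rewrite -redF -rmorphM /= -TE mulrC redp_principal //; exists P.
  by move/eqP; rewrite mulf_eq0 (negPf (irredp_neq0 f_irr)) orbF => /eqP.
apply/pi_quot0P; exists S; apply/eqP; rewrite -subr_eq0; apply/eqP.
by apply: (poly_padic_regular p_pr); rewrite mulrBr TE SE; ring.
Qed.

Lemma padicX_modp_domain : GRing.integral_domain_axiom K.
Proof.
move=> x y; have [x' ->] := pi_modp_onto x; have [y' ->] := pi_modp_onto y.
have [P ->] := pi_quot_onto x'; have [Q ->] := pi_quot_onto y'.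
rewrite -!rmorphM /= => /pi_modp0P/principal_pi_quotP.
rewrite rmorphM /= => /(irreducible_dvd_mul f_irr)/orP[] fP; apply/orP.
  by left; apply/eqP/pi_modp0P/principal_pi_quotP.
by right; apply/eqP/pi_modp0P/principal_pi_quotP.
Qed.

Lemma Fp_to_quot_red (c : padic p) :
  Fp_to_quot F (padic_red c) = pi_modp (padic_to_quot F c).
Proof.
rewrite /Fp_to_quot -(rmorph_nat (@pi_modp _ F)); apply/pi_modp_eqP.
rewrite -(rmorph_nat (@pi_quot _ F)) -rmorphB /=.
apply/principal_pi_quotP; rewrite rmorphB /= map_polyC /= rmorph_nat.
by rewrite -polyC_natr natr_Zp subrr dvdp0.
Qed.

(** [Fp_to_quot] is given on representatives, so its morphism laws are carried over from Z_p along
    the surjection [padic_red]. *)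
Lemma Fp_to_quot_rmorphism :
  exists phi : {rmorphism 'F_p -> K}, phi =1 @Fp_to_quot p F.
Proof.
have zm : zmod_morphism (@Fp_to_quot p F).
  move=> x y; rewrite -(padic_redK x) -(padic_redK y) -rmorphB /=.
  by rewrite !Fp_to_quot_red !rmorphB.
have mm : monoid_morphism (@Fp_to_quot p F).
  split=> [|x y].
    by rewrite -(rmorph1 (@padic_red p)) Fp_to_quot_red !rmorph1.
  rewrite -(padic_redK x) -(padic_redK y) -rmorphM /=.
  by rewrite !Fp_to_quot_red !rmorphM.
pose phiZ := GRing.isZmodMorphism.Build _ _ (@Fp_to_quot p F) zm.
pose phiM := GRing.isMonoidMorphism.Build _ _ (@Fp_to_quot p F) mm.
pose phi : {rmorphism 'F_p -> K} := HB.pack (@Fp_to_quot p F) phiZ phiM.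
by exists phi.
Qed.

Lemma map_Fp_to_quot_red P :
  map_poly (@Fp_to_quot p F) (redp P)
  = map_poly (@pi_modp p F) (map_poly (@padic_to_quot p F) P).
Proof.
have [phi phiE] := Fp_to_quot_rmorphism.
rewrite -(eq_map_poly phiE) -!map_poly_comp.
by apply: eq_map_poly => c /=; rewrite phiE Fp_to_quot_red.
Qed.

Lemma horner_Fp_to_quot P x :
  (map_poly (@Fp_to_quot p F) (redp P)).[pi_modp x]
  = pi_modp (map_poly (@padic_to_quot p F) P).[x].
Proof. by rewrite map_Fp_to_quot_red horner_map. Qed.

(** Says that f is the minimal polynomial of the class of X. *)
Lemma horner_Xbar_eq0 g :
  ((map_poly (@Fp_to_quot p F) g).[Xbar F] == 0) = (f %| g).
Proof.
rewrite -(padic_liftK g) (horner_Fp_to_quot _ (Xim F)) horner_padic_to_quot.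
by apply/eqP/idP => [/pi_modp0P/principal_pi_quotP|/principal_pi_quotP/pi_modp0P].
Qed.

Lemma pchar_modp : p \in [pchar K].
Proof.
apply/andP; split=> //; rewrite -(rmorph_nat (@pi_modp _ F)); apply/eqP.
exact/pi_modp0P/principal_self.
Qed.

Lemma horner_Frobenius g (z : K) (n : nat) :
  (map_poly (@Fp_to_quot p F) g).[z ^+ (p ^ n)]
  = (map_poly (@Fp_to_quot p F) g).[z] ^+ (p ^ n).
Proof.
have [phi phiE] := Fp_to_quot_rmorphism; rewrite -(eq_map_poly phiE).
elim: n => [|n IH]; first by rewrite expn0 !expr1.
rewrite expnSr !exprM -IH -!(pFrobenius_autE pchar_modp) -horner_map /=.
congr (_.[_]); rewrite -map_poly_comp; apply: eq_map_poly => c /=.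
rewrite pFrobenius_autE -rmorphXn /=; congr (phi _).
by have := expf_card c; rewrite card_Fp // => ->.
Qed.

End Quotient.

(** * Division by a polynomial whose leading coefficient is a unit *)

Section UnitLeadCoef.
Variables (R : comNzRingType) (D : {poly R}).
Hypothesis unitD : is_unit (lead_coef D).

Lemma unit_lead_coef_monic :
  exists2 D1 : {poly R}, D1 \is monic /\ size D1 = size D
    & exists2 c, D1 = c%:P * D & D = (lead_coef D)%:P * D1.
Proof.
have [c cD] := unitD.
have DE : D = (lead_coef D)%:P * (c%:P * D).
  by rewrite mulrA -polyCM [_ * c]mulrC cD mul1r.
have sD : size (c%:P * D) = size D.
  apply/eqP; rewrite eqn_leq mul_polyC size_scale_leq /= -mul_polyC.
  by rewrite {1}DE mul_polyC size_scale_leq.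
exists (c%:P * D); last by exists c.
by split=> //; rewrite monicE lead_coefE sD coefCM -lead_coefE cD.
Qed.

Lemma division_unit_lead_coef P :
  exists Q r, P = Q * D + r /\ (size r < size D)%N.
Proof.
have [D1 [mD1 sD1] [c D1E _]] := unit_lead_coef_monic.
exists (Pdiv.Ring.rdivp P D1 * c%:P), (Pdiv.Ring.rmodp P D1); split.
  by rewrite -mulrA -D1E -Pdiv.RingMonic.rdivp_eq.
by rewrite -sD1 Pdiv.Ring.ltn_rmodpN0 // monic_neq0.
Qed.

Lemma small_multiple_unit_lead_coef T :
  (size (T * D)%R < size D)%N -> T * D = 0.
Proof.
have [D1 [mD1 sD1] [c _ DE]] := unit_lead_coef_monic.
have e : T * D = T * (lead_coef D)%:P * D1 by rewrite -mulrA -DE.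
rewrite e -sD1; have [->|T0] := eqVneq (T * (lead_coef D)%:P) 0; rewrite ?mul0r //.
rewrite size_Mmonic // => sT; exfalso.
move: T0; rewrite -size_poly_gt0; lia.
Qed.
End UnitLeadCoef.

(** * p-adic limits of polynomials *)

Section PadicPoly.
Variable p : nat.
Hypothesis p_pr : prime p.
Implicit Types (P Q : {poly padic p}).

Lemma principal_pexp_polyP n P :
  principal (p%:R ^+ n) P <-> forall i, principal (p%:R ^+ n) P`_i.
Proof.
have pnE : (p%:R ^+ n : {poly padic p}) = (p%:R ^+ n)%:P.
  by rewrite polyC_exp polyC_natr.
rewrite pnE; split=> [[r ->] i|/principal_polyP[r ->]]; last by exists r.
by rewrite coefMC; exists r`_i.
Qed.

Lemma poly_padic_separated : adic_separated (p%:R : {poly padic p}).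
Proof.
move=> P PP; apply/polyP => i; rewrite coef0; apply: (padic_separated p_pr).
by move=> n; apply: (principal_pexp_polyP n P).1.
Qed.

(** The uniform bound m makes the coefficientwise limit a polynomial: the partial sums of p^n X^n
    have no limit in Z_p[X]. *)
Lemma poly_padic_complete m (P : nat -> {poly padic p}) :
  (forall n, (size (P n) <= m)%N) ->
  (forall n, principal (p%:R ^+ n) (P n.+1 - P n)) ->
  exists2 L : {poly padic p}, (size L <= m)%N & forall n, principal (p%:R ^+ n) (L - P n).
Proof.
move=> sP dP.
have /choice[L LP] i : exists l, forall n, principal (p%:R ^+ n) (l - (P n)`_i).
  have [n|l lP] := @padic_adic_complete p p_pr (fun n => (P n)`_i); last by exists l.
  by rewrite -coefB; apply: (principal_pexp_polyP n _).1.
exists (\poly_(i < m) L i); first exact: size_poly.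
move=> n; apply/principal_pexp_polyP => i; rewrite coefB coef_poly.
case: ltnP => [_|mi]; first exact: LP.
rewrite (nth_default 0 (leq_trans (sP n) mi)) subrr.
by exists 0; rewrite mul0r.
Qed.

Lemma padic_unit (x : padic p) : padic_red x != 0 -> is_unit x.
Proof.
move=> x0; apply: (adic_unit (padic_adic_complete p_pr) (padic_separated p_pr)
  (padic_field p_pr)).
by move/(padic_red0P p_pr); apply/eqP.
Qed.

End PadicPoly.

(** * Completeness of A when F has the degree of f *)

Section QuotientComplete.
Variables (p : nat) (f : {poly 'F_p}) (F : {poly padic p}).
Hypotheses (p_pr : prime p) (f_irr : irreducible_poly f) (redF : redp F = f).
Hypothesis sizeF : size F = size f.
Local Notation A := (padicX_quot F).

(** Equal degrees make this coefficient reduce to the leading coefficient of f. The condition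
    matters: F = X + p X^2 reduces to X, but factors as X (1 + p X), and A is then not a domain. *)
Lemma lead_coef_unit : is_unit (lead_coef F).
Proof.
apply: (padic_unit p_pr); rewrite lead_coefE -coef_map redF sizeF -lead_coefE.
by rewrite lead_coef_eq0 irredp_neq0.
Qed.

(** With [pi_quot_small_inj], this makes A free over Z_p on the powers of X below deg f, which
    brings separation and completeness up from Z_p. *)
Lemma pi_quot_small (x : A) : exists2 P, x = pi_quot F P & (size P < size F)%N.
Proof.
have [P ->] := pi_quot_onto x.
have [Q [r [-> sr]]] := division_unit_lead_coef lead_coef_unit P.
exists r => //; rewrite rmorphD /= (_ : pi_quot F (Q * F) = 0) ?add0r //.
by apply/(pi_quot0P f_irr redF); exists Q.
Qed.

Lemma pi_quot_small_inj (P Q : {poly padic p}) :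
  (size P < size F)%N -> (size Q < size F)%N ->
  pi_quot F P = pi_quot F Q -> P = Q.
Proof.
move=> sP sQ /eqP; rewrite -subr_eq0 -rmorphB /= => /eqP.
move=> /(pi_quot0P f_irr redF)[T TE].
apply/eqP; rewrite -subr_eq0 TE small_multiple_unit_lead_coef //.
  exact: lead_coef_unit.
rewrite -TE; apply: leq_ltn_trans (size_polyD _ _) _.
by rewrite size_polyN gtn_max sP sQ.
Qed.

Lemma pi_quot_pexp n : pi_quot F (p%:R ^+ n) = p%:R ^+ n.
Proof. by rewrite rmorphXn /= rmorph_nat. Qed.

Lemma padicX_quot_separated : adic_separated (p%:R : A).
Proof.
move=> x xP; have [P PE sP] := pi_quot_small x.
rewrite PE (_ : P = 0) ?rmorph0 //; apply: (poly_padic_separated p_pr) => n.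
have [b bE] := xP n; have [B BE sB] := pi_quot_small b.
exists B; apply: pi_quot_small_inj => //.
  rewrite -natrX mulr_natr; apply: leq_ltn_trans sB.
  by apply/leq_sizeP => i iB; rewrite coefMn nth_default ?mul0rn.
by rewrite rmorphM /= pi_quot_pexp -PE bE BE.
Qed.

Lemma padicX_quot_complete : adic_complete (p%:R : A).
Proof.
move=> u uP.
have /choice[v vP] n : exists v : {poly padic p}, (size v < size F)%N /\
    u n.+1 - u n = pi_quot F (v * p%:R ^+ n).
  have [b bE] := uP n; have [B BE sB] := pi_quot_small b.
  by exists B; split=> //; rewrite rmorphM /= pi_quot_pexp bE BE.
have [P0 P0E sP0] := pi_quot_small (u 0%N).
(* The increments are lifted rather than the terms [u n], so that consecutive lifts are congruent
   modulo p^n in Z_p[X] itself. *)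
pose P n := P0 + \sum_(i < n) v i * p%:R ^+ i.
have PS n : P n.+1 = P n + v n * p%:R ^+ n by rewrite /P big_ord_recr addrA.
have PE n : u n = pi_quot F (P n).
  elim: n => [|n IH]; first by rewrite /P big_ord0 addr0.
  by rewrite PS rmorphD /= -IH -(vP n).2 addrC subrK.
have sP n : (size (P n) <= size F)%N.
  elim: n => [|n IH]; first by rewrite /P big_ord0 addr0 ltnW.
  rewrite PS; apply: leq_trans (size_polyD _ _) _; rewrite geq_max IH /=.
  apply: leq_trans (ltnW (vP n).1); rewrite -natrX mulr_natr.
  by apply/leq_sizeP => i iB; rewrite coefMn nth_default ?mul0rn.
have [n|L _ LP] := poly_padic_complete p_pr sP.
  by rewrite PS addrAC subrr add0r; exists (v n).
exists (pi_quot F L) => n; rewrite PE -rmorphB /=.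
by have [r ->] := LP n; exists (pi_quot F r); rewrite rmorphM /= pi_quot_pexp.
Qed.

End QuotientComplete.

(** * Frobenius conjugates of the class of X *)

Section Conjugates.
Variables (p : nat) (f : {poly 'F_p}) (F : {poly padic p}).
Hypotheses (p_pr : prime p) (f_irr : irreducible_poly f) (redF : redp F = f).
Hypothesis f_monic : f \is monic.
Local Notation A := (padicX_quot F).
Local Notation K := (padicX_quot_modp F).
Local Notation d := (size f).-1.
Local Notation "g ^phi" := (map_poly (@Fp_to_quot p F) g)
  (at level 2, format "g ^phi").
Implicit Types (g : {poly 'F_p}).

Lemma Fp_to_quot_polyB g1 g2 : (g1 - g2)^phi = g1^phi - g2^phi.
Proof.
have [phi phiE] := Fp_to_quot_rmorphism p_pr f_irr redF.
by rewrite -!(eq_map_poly phiE) rmorphB.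
Qed.

Lemma Fp_to_quot_deriv g : (g^`())^phi = (g^phi)^`().
Proof.
have [phi phiE] := Fp_to_quot_rmorphism p_pr f_irr redF.
by rewrite -!(eq_map_poly phiE) deriv_map.
Qed.

Lemma domain_expf_eq0 (z : K) n : (z ^+ n == 0) -> z = 0.
Proof.
elim: n => [|n IH]; first by rewrite expr0 oner_eq0.
rewrite exprS => /eqP/(padicX_modp_domain p_pr f_irr redF)/orP[/eqP//|].
exact: IH.
Qed.

Lemma horner_conjugate_eq0 g i :
  (g^phi.[Xbar F ^+ (p ^ i)] == 0) = (f %| g).
Proof.
rewrite (horner_Frobenius p_pr f_irr redF) -(horner_Xbar_eq0 p_pr f_irr redF).
apply/idP/idP => [/domain_expf_eq0->//|/eqP->].
by rewrite expr0n expn_eq0 -leqn0 leqNgt prime_gt0.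
Qed.

(* Otherwise all p ^ d values g(Xbar) would be roots of X^(p^j) - X^(p^i). *)
Lemma conjugate_degree i j :
  (i < j)%N -> Xbar F ^+ (p ^ i) = Xbar F ^+ (p ^ j) -> (d <= j)%N.
Proof.
move=> ij eij.
pose val (g : {poly_d 'F_p}) : K := (polyn g)^phi.[Xbar F].
pose q : {poly K} := 'X^(p ^ j) - 'X^(p ^ i).
have sq : size q = (p ^ j).+1.
  rewrite size_polyDl ?size_polyXn // size_polyN size_polyXn ltnS.
  by rewrite ltn_exp2l // prime_gt1.
have [||r qE] := @domain_roots_prod _ _ (index_enum {poly_d 'F_p}) val q
  (padicX_modp_domain p_pr f_irr redF) (index_enum_uniq _).
- move=> g1 g2 _ _ /eqP; rewrite /val -subr_eq0 -hornerN -hornerD.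
  rewrite -Fp_to_quot_polyB (horner_Xbar_eq0 p_pr f_irr redF) => fg.
  apply/val_inj/eqP; rewrite /= -subr_eq0; apply: contraTT fg => g0.
  rewrite gtNdvdp //; apply: leq_ltn_trans (size_polyD _ _) _.
  have small (g : {poly_d 'F_p}) : (size (polyn g) < size f)%N.
    apply: leq_ltn_trans (size_npoly g) _.
    by rewrite prednK // size_poly_gt0 irredp_neq0.
  by rewrite size_polyN gtn_max !small.
- apply/allP => g _; rewrite /root !hornerE subr_eq0 /val.
  by rewrite -!(horner_Frobenius p_pr f_irr redF) eij.
have sr : (0 < size r)%N.
  by rewrite size_poly_gt0; apply/eqP => r0; move: sq; rewrite qE r0 mul0r size_poly0.
have mP : \prod_(g <- index_enum {poly_d 'F_p}) ('X - (val g)%:P) \is monic.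
  by apply: monic_prod => g _; apply: monicXsubC.
move: sq; rewrite qE size_Mmonic -?size_poly_gt0 // size_prod_XsubC.
have -> : size (index_enum {poly_d 'F_p}) = (p ^ d)%N.
  by rewrite /index_enum -enumT -cardT card_npoly card_Fp.
move=> e; rewrite -(leq_exp2l _ _ (prime_gt1 p_pr)).
by case: (size r) sr e => // k _; rewrite addnS addSn => -[<-]; rewrite leq_addl.
Qed.

Lemma conjugate_inj : injective (fun i : 'I_d => Xbar F ^+ (p ^ i)).
Proof.
move=> i j e; apply: ord_inj; case: (ltngtP i j) => // ij.
  by have := conjugate_degree ij e; rewrite leqNgt ltn_ord.
by have := conjugate_degree ij (esym e); rewrite leqNgt ltn_ord.
Qed.

Lemma prod_conjugates : \prod_(i < d) ('X - (Xbar F ^+ (p ^ i))%:P) = f^phi.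
Proof.
have [phi phiE] := Fp_to_quot_rmorphism p_pr f_irr redF.
apply/esym/domain_monic_roots_prod.
- exact: padicX_modp_domain p_pr f_irr redF.
- by rewrite -(eq_map_poly phiE) monic_map.
- rewrite -(eq_map_poly phiE) size_map_poly prednK //.
  by rewrite size_poly_gt0 irredp_neq0.
- exact: conjugate_inj.
- by move=> i; rewrite /root horner_conjugate_eq0.
Qed.

(** At the i-th conjugate, f' is the product of the differences with the other conjugates, all
    nonzero in a domain. *)
Lemma deriv_conjugate_neq0 (i : 'I_d) :
  (f^`())^phi.[Xbar F ^+ (p ^ i)] != 0.
Proof.
rewrite Fp_to_quot_deriv -prod_conjugates (bigD1 i) //= derivM derivXsubC mul1r.
rewrite !hornerE subrr mul0r addr0 horner_prod.
elim/big_ind: _ => [|x y x0 y0|j ji]; first exact: oner_neq0.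
  apply/eqP => /(padicX_modp_domain p_pr f_irr redF).
  by rewrite (negPf x0) (negPf y0).
rewrite !hornerE subr_eq0; apply: contra ji => /eqP/conjugate_inj->//.
Qed.

(** Writing g = q f, one has g' = q' f + q f', and the irreducible f divides neither q nor f'. *)
Lemma deriv_dvd_conjugate_neq0 g (i : 'I_d) : f %| g -> ~~ (f ^+ 2 %| g) ->
  (g^`())^phi.[Xbar F ^+ (p ^ i)] != 0.
Proof.
move=> /dvdpP[q ->] fq; rewrite derivM.
have fq' : ~~ (f %| q) by apply: contra fq => ?; rewrite expr2 dvdp_mul.
rewrite horner_conjugate_eq0 dvdp_addr; last exact: dvdp_mull.
apply/negP => /(irreducible_dvd_mul f_irr); rewrite (negPf fq') /=.
by have := deriv_conjugate_neq0 i; rewrite horner_conjugate_eq0 => /negPf->.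
Qed.

End Conjugates.

(** * Lifting the conjugates *)

Section HenselRoots.
Variables (p : nat) (f : {poly 'F_p}) (F : {poly padic p}).
Hypotheses (p_pr : prime p) (f_irr : irreducible_poly f) (redF : redp F = f).
Hypotheses (f_monic : f \is monic) (sizeF : size F = size f).
Local Notation A := (padicX_quot F).
Local Notation d := (size f).-1.
Local Notation quot P := (map_poly (@padic_to_quot p F) P).

Let completeA := padicX_quot_complete p_pr f_irr redF sizeF.
Let separatedA := padicX_quot_separated p_pr f_irr redF sizeF.
Let fieldA := padicX_quot_field p_pr f_irr redF.
Let properA := padicX_quot_proper p_pr f_irr redF.
Let regularA := padicX_quot_regular p_pr f_irr redF.

Lemma padicX_quot_domain : GRing.integral_domain_axiom A.
Proof. exact: (adic_domain completeA separatedA fieldA regularA). Qed.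

Lemma padicX_quot_maximalP (I : set A) :
  is_maximal_ideal I <-> I = principal p%:R.
Proof. exact: (adic_maximalP completeA separatedA fieldA properA). Qed.

Lemma padicX_quot_complete_dvr (R : realType) : is_complete_dvr R A.
Proof.
exact: (adic_complete_dvr completeA separatedA fieldA properA regularA).
Qed.

(** Applied to h and h' at the approximate roots, and to the cofactor of ft at the lifted ones. *)
Lemma principal_horner_conjugate (P : {poly padic p}) (x : A) i :
  principal p%:R (x - Xim F ^+ (p ^ i)) ->
  principal p%:R (quot P).[x] <-> f %| redp P.
Proof.
move=> /(pi_modp_eqP p_pr f_irr redF); rewrite rmorphXn /= => xE.
rewrite -(pi_modp0P p_pr f_irr redF).
rewrite -(horner_Fp_to_quot p_pr f_irr redF) xE.
rewrite -(horner_conjugate_eq0 p_pr f_irr redF _ i).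
by split=> /eqP.
Qed.

Lemma principal_subrr (x : A) : principal p%:R (x - x).
Proof. by rewrite subrr; exists 0; rewrite mul0r. Qed.

Variable h : {poly padic p}.
Hypotheses (fh : f %| redp h) (f2h : ~~ (f ^+ 2 %| redp h)).

Lemma hensel_root_exists_unique (i : 'I_d) :
  exists! x, hensel_root h (Xim F ^+ (p ^ i)) x.
Proof.
set a := Xim F ^+ (p ^ i).
have ha : principal p%:R (quot h).[a].
  exact/(principal_horner_conjugate h (principal_subrr a)).
have h'a : ~ principal p%:R (quot h)^`().[a].
  rewrite deriv_map => /(principal_horner_conjugate _ (principal_subrr a)).
  rewrite -deriv_map -(horner_conjugate_eq0 p_pr f_irr redF _ i).
  by apply/negP; apply: deriv_dvd_conjugate_neq0.
have [c cP] := fieldA h'a.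
have [x [rx xa]] := adic_hensel completeA separatedA ha cP.
exists x; split=> // y [ry ya].
have xy : principal p%:R (x - y).
  have -> : x - y = (x - a) - (y - a) by ring.
  exact: principalB.
apply: (adic_hensel_uniq completeA separatedA fieldA properA _ xy rx ry (c := c)).
have -> : c * (quot h)^`().[x] - 1 =
  c * ((quot h)^`().[x] - (quot h)^`().[a]) + (c * (quot h)^`().[a] - 1) by ring.
by apply: principalD cP; apply/principalMl/horner_cong.
Qed.

Lemma prod_hensel_roots (ft gt : {poly padic p}) (X' : 'I_d -> A) :
  hensel_pair h f ft gt ->
  (forall i : 'I_d, hensel_root h (Xim F ^+ (p ^ i)) (X' i)) ->
  \prod_(i < d) ('X - (X' i)%:P) = quot ft.
Proof.
move=> [mft mgt hE redft redgt] X'P.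
apply/esym/domain_monic_roots_prod.
- exact: padicX_quot_domain.
- by rewrite monic_map.
- rewrite size_map_poly_id0 ?(eqP mft) ?rmorph1 ?oner_neq0 //.
  rewrite -redft size_map_poly_id0 ?(eqP mft) ?rmorph1 ?oner_neq0 // prednK //.
  by rewrite size_poly_gt0 monic_neq0.
- move=> i j e; apply: (conjugate_inj p_pr f_irr redF).
  have [[_ Xi] [_ Xj]] := (X'P i, X'P j).
  move: Xi Xj => /(pi_modp_eqP p_pr f_irr redF) + /(pi_modp_eqP p_pr f_irr redF).
  by rewrite e !rmorphXn /= => -> .
- move=> i; have [/eqP + Xi] := X'P i; rewrite hE rmorphM /= hornerM.
  move=> /padicX_quot_domain/orP[//|/eqP g0].
  have : principal p%:R (quot gt).[X' i] by rewrite g0; exists 0; rewrite mul0r.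
  move=> /(principal_horner_conjugate _ Xi); rewrite redgt => fg.
  by move: f2h; rewrite expr2 -(divpK fh) dvdp_mul.
Qed.

End HenselRoots.

(** * Hensel factorization *)

Section HenselFactorization.
Variables (p : nat) (f g : {poly 'F_p}) (h : {poly padic p}).
Hypotheses (p_pr : prime p) (f_monic : f \is monic) (cfg : coprimep f g).
Hypothesis redh : redp h = g * f.

Lemma padic_lift_monic : padic_lift f \is monic.
Proof.
have e : (nat_of_ord f`_(size f).-1)%:R = 1 :> padic p.
  by rewrite -lead_coefE (eqP f_monic).
by rewrite monicE lead_coef_poly /= ?e ?oner_neq0 // size_poly_gt0 monic_neq0.
Qed.

Lemma size_lift_monic (P : {poly padic p}) :
  P \is monic -> redp P = f -> size P = size f.
Proof.
move=> mP <-.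
by rewrite size_map_poly_id0 // (eqP mP) rmorph1 oner_neq0.
Qed.

Definition approx_factor n (P : {poly padic p}) :=
  [/\ P \is monic, redp P = f & exists Q r, h = Q * P + r * p%:R ^+ n].

Lemma redp_pM (s : {poly padic p}) n : redp (s * p%:R ^+ n.+1) = 0.
Proof.
by apply/(redp0P p_pr); rewrite exprS; exists (s * p%:R ^+ n); rewrite mulrCA mulrC.
Qed.

(** Replacing P by P + p^(n+1) a and Q by Q + p^(n+1) W improves the congruence once r = g a + W f
    modulo p. Bezout solves this, and reducing v r modulo f keeps deg a < deg f, hence P' monic. *)
Lemma approx_factor_step n (P : {poly padic p}) : approx_factor n.+1 P ->
  exists P', approx_factor n.+2 P' /\ principal (p%:R ^+ n.+1) (P' - P).
Proof.
move=> [mP redP [Q [r hE]]].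
have redQ : redp Q = g.
  have := redh; rewrite hE rmorphD rmorphM /= redp_pM addr0 redP.
  by apply/mulIf/monic_neq0.
have [[u v] /= uv] := Bezout_eq1_coprimepP f g cfg.
pose t := (v * redp r) %/ f; pose a := (v * redp r) %% f.
have vE : v * redp r = t * f + a := divp_eq _ _.
pose P' := P + padic_lift a * p%:R ^+ n.+1.
have redP' : redp P' = f by rewrite rmorphD /= redp_pM addr0.
(* The term g t restores what was removed in passing from v r to its remainder a. *)
pose W := padic_lift (u * redp r + g * t).
have [s sE] : principal p%:R (r - Q * padic_lift a - W * P').
  apply/(redp0P p_pr); rewrite !rmorphB !rmorphM /= redQ redP' !padic_liftK.
  have -> : redp r - g * a - (u * redp r + g * t) * f
    = (1 - (u * f + v * g)) * redp r + g * (v * redp r - (t * f + a)) by ring.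
  by rewrite uv subrr mul0r add0r vE subrr mulr0.
exists P'; split; last first.
  by exists (padic_lift a); rewrite /P' addrAC subrr add0r.
split=> //.
  rewrite monicE lead_coefDl ?(eqP mP) // -natrX mulr_natr.
  rewrite (size_lift_monic mP redP).
  apply: (@leq_ltn_trans (size a)).
    apply: leq_trans (size_padic_lift a).
    by apply/leq_sizeP => i iB; rewrite coefMn nth_default ?mul0rn.
  by rewrite ltn_modp monic_neq0.
exists (Q + W * p%:R ^+ n.+1), s.
have rE : r = Q * padic_lift a + W * P' + s * p%:R by rewrite -sE; ring.
by rewrite {1}hE {1}rE /P' [p%:R ^+ n.+2]exprS; ring.
Qed.

Hypothesis f_irr : irreducible_poly f.

Lemma hensel_factor : exists ft gt : {poly padic p},
  [/\ ft \is monic, redp ft = f & h = gt * ft].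
Proof.
have /choice[step stepP] (z : nat * {poly padic p}) : exists w,
    approx_factor z.1.+1 z.2 ->
    approx_factor z.1.+2 w /\ principal (p%:R ^+ z.1.+1) (w - z.2).
  case: z => n P /=.
  have [/approx_factor_step[P' P'P]|nP] := pselect (approx_factor n.+1 P).
    by exists P'.
  (* A default value; by [uP] the iteration only meets approximate factors. *)
  by exists 0 => /nP.
pose u := fix u n := if n is n'.+1 then step (n', u n') else padic_lift f.
have uP n : approx_factor n.+1 (u n).
  elim: n => [|n IH]; last by case: (stepP (n, u n) IH).
  split; [exact: padic_lift_monic | exact: padic_liftK |].
  have [r rE] : principal p%:R (h - padic_lift g * padic_lift f).
    by apply/(redp0P p_pr); rewrite rmorphB rmorphM /= !padic_liftK redh subrr.
  by exists (padic_lift g), r; rewrite expr1 -rE addrC subrK.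
have su n : size (u n) = size f.
  by have [mu ru _] := uP n; apply: size_lift_monic.
have [n|n|L sL LP] := @poly_padic_complete p p_pr (size f) u.
- by rewrite su.
- apply: principal_trans (stepP (n, u n) (uP n)).2.
  exact: principal_exp.
have redL : redp L = f.
  have [_ <- _] := uP 1%N; apply/eqP; rewrite -subr_eq0 -rmorphB /=.
  by apply/eqP/(redp0P p_pr); have := LP 1%N; rewrite expr1.
have mL : L \is monic.
  have Lf : L`_(size f).-1 = 1.
    apply/eqP; rewrite -subr_eq0; apply/eqP/(padic_separated p_pr) => n.
    have [mu _ _] := uP n; rewrite -{2}(eqP mu) lead_coefE su -coefB.
    exact: (principal_pexp_polyP n _).1.
  have sL' : size L = size f.
    apply/eqP; rewrite eqn_leq sL /=.
    rewrite -[X in (X <= _)%N]prednK ?size_poly_gt0 ?monic_neq0 //.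
    by rewrite ltnNge; apply/negP => /(nth_default 0)/eqP; rewrite Lf oner_eq0.
  by rewrite monicE lead_coefE sL' Lf.
(* The cofactors need not be shown to converge: h is divisible by every p^n in Z_p[X]/(L), which is
   separated, so h vanishes there. *)
suff [gt gtE] : principal L h by exists L, gt.
apply/(pi_quot0P f_irr redL)/(padicX_quot_separated p_pr f_irr redL).
  exact: size_lift_monic.
move=> n; have [_ _ [Q [r hE]]] := uP n; have [s sE] := LP n.
(* Substituting u n = L - s p^n in h = Q (u n) + r p^(n+1) gives h = Q L + p^n (r p - Q s). *)
exists (pi_quot L (r * p%:R - Q * s)).
rewrite -(pi_quot_pexp L n) -rmorphM /=; apply/eqP; rewrite -subr_eq0 -rmorphB /=.
apply/eqP/(pi_quot0P f_irr redL); exists Q.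
have uE : u n = L - s * p%:R ^+ n by rewrite -sE; ring.
by rewrite hE uE exprSr; ring.
Qed.

End HenselFactorization.

(** * Existence and uniqueness of the lifted pair *)

Section HenselPair.
Variables (p : nat) (f : {poly 'F_p}) (h : {poly padic p}).
Hypotheses (p_pr : prime p) (h_monic : h \is monic) (f_monic : f \is monic).
Hypotheses (f_irr : irreducible_poly f).
Hypotheses (fh : f %| redp h) (f2h : ~~ (f ^+ 2 %| redp h)).

Lemma cofactor_not_dvd : ~~ (f %| redp h %/ f).
Proof. by apply: contra f2h => fg; rewrite expr2 -(divpK fh) dvdp_mul. Qed.

Lemma hensel_pair_exists :
  exists ft gt : {poly padic p}, hensel_pair h f ft gt.
Proof.
have cfg : coprimep f (redp h %/ f).
  by rewrite irreducible_poly_coprime // cofactor_not_dvd.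
have [ft [gt [mft redft hE]]] :=
  hensel_factor p_pr f_monic cfg (esym (divpK fh)) f_irr.
exists ft, gt; split=> //; last 1 first.
- by rewrite hE rmorphM /= redft mulpK // monic_neq0.
- by move: h_monic; rewrite hE monicMr.
- by rewrite mulrC.
Qed.

(* Z_p[X]/(ft2) is a domain in which ft1 * gt1 = h vanishes but gt1 does not. *)
Lemma hensel_pair_unique (ft1 gt1 ft2 gt2 : {poly padic p}) :
  hensel_pair h f ft1 gt1 -> hensel_pair h f ft2 gt2 -> (ft1, gt1) = (ft2, gt2).
Proof.
move=> [m1 _ h1 r1 s1] [m2 _ h2 r2 _].
have sz2 := size_lift_monic m2 r2.
have : pi_quot ft2 ft1 * pi_quot ft2 gt1 = 0.
  rewrite -rmorphM -h1 /=; apply/(pi_quot0P f_irr r2).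
  by exists gt2; rewrite h2 mulrC.
move/(padicX_quot_domain p_pr f_irr r2 sz2)/orP => [] /eqP.
  move=> /(pi_quot0P f_irr r2)[c cE].
  have mc : c \is monic by move: m1; rewrite cE monicMr.
  have c1 : c = 1.
    apply: monic_size1 => //.
    have := size_lift_monic m1 r1; rewrite cE size_Mmonic ?monic_neq0 // sz2.
    have f0 : (0 < size f)%N by rewrite size_poly_gt0 monic_neq0.
    rewrite -(prednK f0) addnS /= -[in RHS]add1n => /eqP.
    by rewrite eqn_add2r => /eqP.
  have e : ft1 = ft2 by rewrite cE c1 mul1r.
  by congr pair => //; apply: (monic_lreg m2); rewrite -h2 h1 e.
move=> /(pi_quot0P f_irr r2)[c cE].
by case/negP: cofactor_not_dvd; rewrite -s1 cE rmorphM /= r2 dvdp_mull.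
Qed.

End HenselPair.

Unset Implicit Arguments.

Theorem theorem3p5 (R : realType) (p : nat) (h : {poly padic p}) (f : {poly 'F_p}) :
  prime p -> h \is monic ->
  f \is monic -> irreducible_poly f -> (1 < size f)%N ->
  f %| redp h -> ~~ (f ^+ 2 %| redp h) ->
  (exists! fg : {poly padic p} * {poly padic p}, hensel_pair h f fg.1 fg.2) /\
  forall ft gt F : {poly padic p}, hensel_pair h f ft gt -> redp F = f ->
  [/\ size F = size f ->
        is_complete_dvr R (padicX_quot F) /\
        forall I : set (padicX_quot F), is_maximal_ideal I <-> I = principal p%:R,
      \prod_(i < (size f).-1) ('X - (Xbar F ^+ (p ^ i))%:P)
        = map_poly (@Fp_to_quot p F) f,
      forall i : 'I_(size f).-1,
        (map_poly (@Fp_to_quot p F) (redp h)^`()).[Xbar F ^+ (p ^ i)] != 0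
    & size F = size f ->
        (forall i : 'I_(size f).-1,
           exists! x, hensel_root h (Xim F ^+ (p ^ i)) x) /\
        forall X' : 'I_(size f).-1 -> padicX_quot F,
          (forall i : 'I_(size f).-1, hensel_root h (Xim F ^+ (p ^ i)) (X' i)) ->
          \prod_(i < (size f).-1) ('X - (X' i)%:P)
            = map_poly (@padic_to_quot p F) ft].
Proof.
move=> p_pr mh mf f_irr _ fh f2h; split.
  have [ft [gt ftgt]] := hensel_pair_exists p_pr mh mf f_irr fh f2h.
  exists (ft, gt); split=> // -[ft' gt'] /=.
  exact: (hensel_pair_unique p_pr mf f_irr fh f2h ftgt).
move=> ft gt F ftgt redF; split.
- move=> sizeF; split; first exact: (padicX_quot_complete_dvr p_pr f_irr redF).
  exact: (padicX_quot_maximalP p_pr f_irr redF).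
- exact: prod_conjugates.
- by move=> i; apply: (deriv_dvd_conjugate_neq0 p_pr f_irr redF).
- move=> sizeF; split; first exact: hensel_root_exists_unique.
  by move=> X'; apply: prod_hensel_roots ftgt.
Qed.
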